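(* Let $x,w\in\mathbb{R}^d$ with $\|x\|_w>0$, and let $\epsilon>0$, $\delta\in(0,1)$. Let $r,m$ be positive integers with $m>\frac{136}{\epsilon^2}\Delta(x,w)^4$ and $r>12\ln(1/\delta)$. Let $\rho(x,w)$ be the streaming estimate defined in the context. Then with probability at least $1-\delta$, $$(1-\epsilon)\|x\|_w^2<\rho(x,w)<(1+\epsilon)\|x\|_w^2.$$
   Context: $\|x\|_w=\sqrt{\sum_{t=1}^d w_t^2x_t^2}$; $\|\cdot\|_2$ is the Euclidean norm; the distortion is $\Delta(x,w)=\|x\|_2\|w\|_2/\|x\|_w$. Sketch: for $a=1,\dots,r$ and $b=1,\dots,m$, let $h_{ab}:\{1,\dots,d\}\to\{1,-1,\mathrm{i},-\mathrm{i}\}$ be mutually independent random functions, each such that the values $h_{ab}(1),\dots,h_{ab}(d)$ are 8-wise independent and each uniformly distributed on $\{1,-1,\mathrm{i},-\mathrm{i}\}$ ($\mathrm{i}$ the imaginary unit). Set $C_x[a,b]=\sum_{t=1}^d x_t h_{ab}(t)$, $C_w[a,b]=\sum_{t=1}^d w_t h_{ab}(t)$, $\hat x^{(ab)}=C_x[a,b]^2C_w[a,b]^2$, $\hat x^{(a)}=\frac1m\sum_{b=1}^m\hat x^{(ab)}$, $\tilde x^{(a)}=\mathrm{Re}(\hat x^{(a)})$, and let $\rho(x,w)$ be the median of $\tilde x^{(1)},\dots,\tilde x^{(r)}$. *)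

(* Defs.v *)
From HB Require Import structures.
From mathcomp Require Import all_boot all_order all_algebra.
From mathcomp Require Import all_classical all_reals all_analysis.
From mathcomp Require Export complex.
Set Implicit Arguments.
Unset Strict Implicit.
Unset Printing Implicit Defensive.
Import Order.TTheory GRing.Theory Num.Theory.
Import numFieldNormedType.Exports.

Local Open Scope classical_set_scope.
Local Open Scope ring_scope.
Local Open Scope complex_scope.

(* Random elements with values in a finite set.  The codomain F carries the
   discrete sigma-algebra, so the events about X are the X @^-1` A for
   arbitrary A : set F. *)
Section finite_random_elements.
Context {disp : measure_display} {T : measurableType disp} {R : realType}.
Variable P : probability T R.

Definition random_element (F : finType) (X : T -> F) : Prop :=
  forall A : set F, measurable (X @^-1` A).

Definition uniformly_distributed (F : finType) (X : T -> F) : Prop :=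
  forall v : F, P (X @^-1` [set v]) = (#|F|%:R^-1)%:E.

Definition product_rule (I F : finType) (X : I -> T -> F) (J : {set I}) : Prop :=
  forall A : I -> set F,
    P (\bigcap_(i in [set` J]) (X i @^-1` A i)) =
    (\prod_(i in J) P (X i @^-1` A i))%E.

Definition mutually_independent (I F : finType) (X : I -> T -> F) : Prop :=
  forall J : {set I}, product_rule X J.

(* "At most k" rather than "exactly k", so that the notion is not vacuous for a
   family with fewer than k members; for larger families the two agree. *)
Definition k_wise_independent (k : nat) (I F : finType) (X : I -> T -> F) : Prop :=
  forall J : {set I}, (#|J| <= k)%N -> product_rule X J.

End finite_random_elements.

Section sketch.
Variable R : realType.

Definition wnorm d (w x : 'rV[R]_d) : R :=
  Num.sqrt (\sum_(t < d) w 0 t ^+ 2 * x 0 t ^+ 2).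

(* The norm that MathComp-Analysis puts on 'rV is the sup norm. *)
Definition l2norm d (x : 'rV[R]_d) : R := Num.sqrt (\sum_(t < d) x 0 t ^+ 2).

Definition distortion d (x w : 'rV[R]_d) : R :=
  l2norm x * l2norm w / wnorm w x.

(* The delimiter %C matters: a bare 'i may be read as the imaginary unit of the
   abstract numClosedField structure of R[i]. *)
Definition root4_seq : seq R[i] := [:: 1; -1; 'i%C; - 'i%C].

Definition root4 : Type := seq_sub root4_seq.
HB.instance Definition _ := Finite.on root4.

Lemma card_root4 : #|{: root4}| = 4%N.
Proof.
have n10 : (1 : R) == 0 = false by rewrite oner_eq0.
have n11 : (1 : R) == -1 = false by rewrite eq_sym eqNr oner_eq0.
by rewrite card_seq_sub /root4_seq //= !inE !negb_or !eq_complex /= !oppr0 !(eq_sym 0)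
           ?eqr_oppLR ?oppr0 ?n10 ?n11 ?oppr_eq0 ?n10 !(eqxx, andbF).
Qed.

Definition sketch_entry d (x : 'rV[R]_d) (h : {ffun 'I_d -> root4}) : R[i] :=
  \sum_(t < d) (x 0 t)%:C * (ssval (h t) : R[i]).

Definition basic_estimate d (x w : 'rV[R]_d) (h : {ffun 'I_d -> root4}) : R[i] :=
  sketch_entry x h ^+ 2 * sketch_entry w h ^+ 2.

Definition row_estimate d m (x w : 'rV[R]_d)
    (h : 'I_m -> {ffun 'I_d -> root4}) : R :=
  complex.Re (m%:R^-1 * \sum_(b < m) basic_estimate x w (h b)).

(* For an even number of terms this is the average of the two middle ones; for
   an odd number the two indices coincide. *)
Definition median (s : seq R) : R :=
  let s' := sort <=%R s in (s'`_(size s).-1./2 + s'`_(size s)./2) / 2.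

Definition rho d r m (x w : 'rV[R]_d)
    (h : 'I_r -> 'I_m -> {ffun 'I_d -> root4}) : R :=
  median [seq row_estimate x w (h a) | a <- enum 'I_r].

End sketch.

(* Main.v *)
(** The law of the hash functions is a product of laws on a finite set, so every
probability below is a finite sum.  By 8-wise independence a monomial of degree
at most 8 in the [h t] and their conjugates [h t ^+ 3] has expectation 1 if every
exponent is divisible by 4, and 0 otherwise.  Hence the basic estimate has mean
[wnorm w x ^+ 2].  In the expectation of its squared modulus the surviving pairs
of 4-tuples [(t, s)] are those where [s] permutes [t], or where both are constant;
AM-GM over the 24 permutations bounds it by
[25 (l2norm x * l2norm w) ^+ 4].  By Chebyshev's inequality each row then fails
with probability at most [25 / 136 < 1 / 4].  The median can only fail if at least
half of the rows fail, which by a Chernoff bound has probability at most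
[(7 / 8) ^+ r <= exp (- r / 12) < delta]. *)

Require Import Defs.
From HB Require Import structures.
From mathcomp Require Import all_boot all_order all_algebra all_fingroup.
From mathcomp Require Import all_classical all_reals all_analysis.
From mathcomp Require Import ring lra zify.
Set Implicit Arguments.
Unset Strict Implicit.
Unset Printing Implicit Defensive.
Import Order.TTheory GRing.Theory Num.Theory.
Import numFieldNormedType.Exports.

Local Open Scope ring_scope.

(** * Finite product laws: second moments, Chebyshev and Chernoff bounds *)

Section ProductWeight.
Variables (R : realFieldType) (I F : finType) (q : I -> F -> R).

(** The joint law of independent coordinates with laws [q i]. It is used at two levels: for the hash
    functions of one row, and for the rows of the whole sketch. *)
Definition prodw (G : {ffun I -> F}) : R := \prod_i q i (G i).

Lemma sum_prodwM (g : I -> F -> R) :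
  \sum_G prodw G * \prod_i g i (G i) = \prod_i \sum_f q i f * g i f.
Proof. by rewrite bigA_distr_bigA; apply: eq_bigr => G _; rewrite -big_split. Qed.

Hypothesis q_ge0 : forall i f, 0 <= q i f.
Hypothesis sum_q : forall i, \sum_f q i f = 1.

Lemma prodw_ge0 G : 0 <= prodw G.
Proof. exact: prodr_ge0. Qed.

Lemma sum_prodw : \sum_G prodw G = 1.
Proof.
transitivity (\prod_(i : I) \sum_f q i f); last by rewrite big1.
by rewrite bigA_distr_bigA.
Qed.

(** Variances of independent centred variables add: in the expanded square every cross term contains
    a factor of mean zero. *)
Lemma sum_prodw_sqr (Z : I -> F -> R) :
    (forall i, \sum_f q i f * Z i f = 0) ->
  \sum_G prodw G * (\sum_i Z i (G i)) ^+ 2 = \sum_i \sum_f q i f * Z i f ^+ 2.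
Proof.
move=> Z0.
(* Writes [Z i * Z j] as a product over all coordinates [k], as [sum_prodwM] requires. For [i = j]
   the two conditionals together produce the square. *)
pose g i j k f : R := (if k == i then Z k f else 1) * (if k == j then Z k f else 1).
have gE i j (G : {ffun I -> F}) : Z i (G i) * Z j (G j) = \prod_k g i j k (G k).
  by rewrite big_split /= -2!big_mkcond !big_pred1_eq.
under eq_bigr => G _.
  rewrite expr2 mulr_suml mulr_sumr.
  under eq_bigr => i _ do rewrite mulr_sumr mulr_sumr.
  over.
rewrite exchange_big; apply: eq_bigr => i _ /=.
rewrite exchange_big (bigD1 i) //= [X in _ + X]big1 => [|j jNi].
  rewrite addr0; under eq_bigr => G _ do rewrite gE.
  rewrite sum_prodwM (bigD1 i) //= [X in _ * X]big1 => [|k /negPf kNi].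
    by rewrite mulr1; apply: eq_bigr => f _; rewrite /g eqxx expr2.
  by rewrite -(sum_q k); apply: eq_bigr => f _; rewrite /g kNi !mulr1.
under eq_bigr => G _ do rewrite gE.
have gi0 : \sum_f q i f * g i j i f = 0.
  rewrite -[RHS](Z0 i); apply: eq_bigr => f _.
  by rewrite /g eqxx eq_sym (negPf jNi) mulr1.
by rewrite sum_prodwM (bigD1 i) //= gi0 mul0r.
Qed.

Lemma prodw_chebyshev (Z : I -> F -> R) (c : R) :
    (forall i, \sum_f q i f * Z i f = 0) -> 0 <= c ->
  c ^+ 2 * \sum_(G : {ffun I -> F} | c <= `|\sum_i Z i (G i)|) prodw G
    <= \sum_i \sum_f q i f * Z i f ^+ 2.
Proof.
move=> Z0 c0; rewrite -sum_prodw_sqr // mulr_sumr big_mkcond /=.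
apply: ler_sum => G _; case: ifP => [cZ|_]; last first.
  by rewrite mulr_ge0 ?prodw_ge0 ?sqr_ge0.
rewrite mulrC ler_wpM2l ?prodw_ge0 // -[leRHS]real_normK ?num_real //.
by rewrite ler_sqr ?nnegrE.
Qed.

(* Markov's inequality for [4 ^ N / 2 ^ #|I|], where [N] is the number of
   coordinates satisfying [bad]. *)
Lemma prodw_chernoff (bad : I -> pred F) :
    (forall i, \sum_(f | bad i f) q i f <= 4^-1) ->
  \sum_(G : {ffun I -> F} | (#|I| <= 2 * #|[set i | bad i (G i)]|)%N) prodw G
    <= (7 / 8) ^+ #|I|.
Proof.
move=> qbad.
pose g i f : R := if bad i f then 2 else 2^-1.
have gE (G : {ffun I -> F}) : \prod_i g i (G i) =
    4 ^+ #|[set i | bad i (G i)]| / 2 ^+ #|I|.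
  rewrite (eq_bigr (fun i => (if bad i (G i) then 4 else 1) * 2^-1)); last first.
    by move=> i _; rewrite /g; case: ifP => _; lra.
  rewrite big_split /= -big_mkcond /= -exprVn.
  rewrite -!prodr_const; congr (_ * _).
  by apply: eq_bigl => i; rewrite inE.
apply: (@le_trans _ _ (\sum_G prodw G * \prod_i g i (G i))).
  rewrite big_mkcond; apply: ler_sum => G _; case: ifP => [G2|_]; last first.
    by rewrite mulr_ge0 ?prodw_ge0 // gE divr_ge0 ?exprn_ge0.
  (* On the event [2 ^ #|I| <= 2 ^ (2 * N) = 4 ^ N], so the product of the [g i] is at least 1
     there. *)
  rewrite ler_peMr ?prodw_ge0 // gE ler_pdivlMr ?exprn_gt0 // mul1r.
  by rewrite (_ : 4 = 2 ^+ 2) -?exprM ?ler_weXn2l //; lra.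
rewrite sum_prodwM -prodr_const; apply: ler_prod => i _; apply/andP; split.
  by apply: sumr_ge0 => f _; rewrite mulr_ge0 ?q_ge0 // /g; case: ifP => _; lra.
(* [g] is [1 / 2] plus [3 / 2] times the indicator of [bad], so its mean is at most
   [1 / 2 + 3 / 8 = 7 / 8]. *)
rewrite (eq_bigr (fun f => 2^-1 * q i f + 3 / 2 * (if bad i f then q i f else 0))).
  rewrite big_split /= -!mulr_sumr sum_q -big_mkcond /=.
  by have := qbad i; lra.
by move=> f _; rewrite /g; case: ifP => _; lra.
Qed.
End ProductWeight.

(** * Localisation of the median *)

Lemma median_in_interval (R : realType) (s : seq R) (lo hi : R) :
    (2 * count (fun y : R => ~~ (lo < y < hi)%R) s < size s)%N ->
  lo < median s < hi.
Proof.
move=> bad; pose s' := sort <=%R s.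
have s's : size s' = size s by rewrite size_sort.
have ss : sorted <=%R s' by apply: sort_sorted; exact: le_total.
have {}bad : (2 * count (fun y : R => ~~ (lo < y < hi)%R) s' < size s)%N.
  by rewrite (seq.permP (permEl (perm_sort _ s))).
rewrite /median -/s' /=; clearbody s'.
(* Covers both middle positions. If the entry at [k] is at most [lo], so are the [k.+1] entries up
   to it; if it is at least [hi], so are the [size s' - k] entries from it on. Either block holds at
   least half of the list. *)
have mid k : ((size s).-1./2 <= k <= (size s)./2)%N -> lo < s'`_k < hi.
  move=> /andP[k1 k2].
  have ks : (k < size s')%N by rewrite s's; lia.
  apply/negPn/negP => /nandP[]; rewrite -leNgt => bk.
    suff : (k.+1 <= count (fun y : R => ~~ (lo < y < hi)%R) s')%N by lia.
    rewrite -[s' in leqRHS](cat_take_drop k.+1) count_cat.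
    apply: leq_trans (leq_addr _ _).
    have : all (fun y : R => ~~ (lo < y < hi)) (take k.+1 s').
      apply/(all_nthP 0) => j; rewrite size_takel // => jk.
      rewrite nth_take // negb_and -leNgt (le_trans _ bk) //.
      by apply: (sorted_leq_nth le_trans le_refl 0 ss); rewrite ?inE // (leq_trans jk).
    by rewrite all_count size_takel // => /eqP ->.
  suff : (size s' - k <= count (fun y : R => ~~ (lo < y < hi)%R) s')%N by lia.
  rewrite -[s' in leqRHS](cat_take_drop k) count_cat.
  apply: leq_trans (leq_addl _ _).
  have : all (fun y : R => ~~ (lo < y < hi)) (drop k s').
    apply/(all_nthP 0) => j; rewrite size_drop => jk.
    rewrite nth_drop negb_and -!leNgt (le_trans bk) ?orbT //.
    by apply: (sorted_leq_nth le_trans le_refl 0 ss); rewrite ?inE ?leq_addr -?ltn_subRL.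
  by rewrite all_count size_drop => /eqP ->.
have /andP[] := mid (size s).-1./2 ltac:(lia).
have /andP[] := mid (size s)./2 ltac:(lia).
by lra.
Qed.

Lemma count_enum (T : finType) (a : pred T) : count a (enum T) = #|a|.
Proof.
rewrite cardE -size_filter /enum_mem -filter_predI; congr (size _).
by apply: eq_filter => y; rewrite /= andbT.
Qed.

(** * Multiplicities of indices in 4-tuples *)

Section Occurrences.
Variable d : nat.
Implicit Types t s : {ffun 'I_4 -> 'I_d}.

(** The exponent of the variable with index [i] in the monomial attached to the tuple [t]. *)
Definition occ t (i : 'I_d) : nat := #|[pred j | t j == i]|.

Lemma occ_le4 t i : (occ t i <= 4)%N.
Proof. by rewrite -[leqRHS]card_ord max_card. Qed.

Lemma occ_gt0 t j : (0 < occ t (t j))%N.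
Proof. by apply/card_gt0P; exists j; rewrite inE. Qed.

Lemma prod_occ (C : comNzRingType) t (phi : 'I_d -> C) :
  \prod_j phi (t j) = \prod_i phi i ^+ occ t i.
Proof.
rewrite (partition_big t xpredT) //=; apply: eq_bigr => i _.
by rewrite -prodr_const; apply: eq_bigr => j /eqP ->.
Qed.

Lemma occ4P t i : reflect (forall j, t j = i) (occ t i == 4%N).
Proof.
apply: (iffP eqP) => [t4 j|ti].
  have /card0_eq /(_ j) : #|[predC [pred j | t j == i]]| = 0%N.
    have := cardC [pred j | t j == i]; rewrite card_ord.
    by rewrite -/(occ t i) t4 => /eqP; rewrite -[X in _ == X]addn0 eqn_add2l => /eqP.
  by rewrite !inE => /negbFE /eqP.
by rewrite -[RHS]card_ord; apply: eq_card => j; rewrite !inE ti eqxx.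
Qed.

Definition constant_ffun t := [forall j, t j == t ord0].

Lemma constant_ffunP t i : (forall j, t j = i) -> constant_ffun t.
Proof. by move=> ti; apply/forallP => j; rewrite !ti. Qed.

Lemma occ_constant t i i' : (forall j, t j = i) -> occ t i' = (4 * (i' == i))%N.
Proof.
move=> ti; have [->|i'i] := eqVneq; first exact/eqP/occ4P.
by rewrite muln0; apply: eq_card0 => j; rewrite !inE ti eq_sym; apply/negbTE.
Qed.

(** An index that occurs at all occurs between 1 and 4 times, so divisibility by 4 makes it fill the
    whole tuple. *)
Lemma dvdn4_occ t : [forall i, 4 %| occ t i]%N = constant_ffun t.
Proof.
apply/forallP/forallP => [t4 j|tc i].
  suff /eqP/occ4P t0 : occ t (t ord0) = 4%N by rewrite t0.
  by have := t4 (t ord0); have := occ_gt0 t ord0; have := occ_le4 t (t ord0); lia.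
by rewrite (occ_constant _ (fun j => eqP (tc j))) dvdn_mulr.
Qed.

Lemma occ_perm t s : (forall i, occ t i = occ s i) ->
  exists sigma : 'S_4, s = [ffun j => t (sigma j)].
Proof.
have cnt (u : {ffun 'I_4 -> 'I_d}) i : count_mem i [tuple u j | j < 4] = occ u i.
  by rewrite /= count_map count_enum.
move=> ts.
have /tuple_permP[sigma e] : perm_eq [tuple s j | j < 4] [tuple t j | j < 4].
  by apply/allP => i _; rewrite /= !cnt ts.
exists sigma; apply/ffunP => j; rewrite ffunE.
have := congr1 (fun l => nth (s j) l j) e.
by rewrite !nth_mktuple tnth_mktuple.
Qed.

(* [occ t i] and [occ s i] are at most 4 and congruent modulo 4, so they are equal
   or one of them is 4 and the other 0. *)
Lemma dvdn4_occD3 t s : (forall i, (4 %| occ t i + 3 * occ s i)%N) ->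
  (exists sigma : 'S_4, s = [ffun j => t (sigma j)]) \/
  constant_ffun t /\ constant_ffun s.
Proof.
move=> d4.
have [/forallP e|] := boolP [forall i, occ t i == occ s i].
  by left; apply: occ_perm => i; apply/eqP.
rewrite negb_forall => /existsP[i nei]; right.
have [[/eqP/occ4P ti si]|[ti /eqP/occ4P si]] :
    (occ t i = 4 /\ occ s i = 0 \/ occ t i = 0 /\ occ s i = 4)%N.
- by have := d4 i; have := occ_le4 t i; have := occ_le4 s i; lia.
- split; first exact: constant_ffunP ti.
  have s0 := occ_gt0 s ord0.
  have nes : (s ord0 == i) = false by apply/eqP => e; rewrite e si in s0.
  (* Since [t] contains only [i], the total exponent at [s ord0] is [3 * occ s (s ord0)]. As 4
     divides it and 3 is coprime to 4, this positive multiplicity must be 4. *)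
  apply: (@constant_ffunP _ (s ord0)); apply/occ4P/eqP.
  have := d4 (s ord0); rewrite (occ_constant _ ti) nes.
  by have := occ_le4 s (s ord0); lia.
- split; last exact: constant_ffunP si.
  have t0 := occ_gt0 t ord0.
  have net : (t ord0 == i) = false by apply/eqP => e; rewrite e ti in t0.
  apply: (@constant_ffunP _ (t ord0)); apply/occ4P/eqP.
  have := d4 (t ord0); rewrite (occ_constant _ si) net.
  by have := occ_le4 t (t ord0); lia.
Qed.

(** Two 4-tuples involve at most 8 distinct indices; this is what makes 8-wise independence
    sufficient for second moments. *)
Lemma card_occ_support t s :
  (#|[set i | (occ t i + 3 * occ s i != 0)%N]| <= 8)%N.
Proof.
have /subset_leq_card : [set i | (occ t i + 3 * occ s i != 0)%N]
    \subset (t @: 'I_4) :|: (s @: 'I_4).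
  apply/fintype.subsetP => i; rewrite !inE -lt0n addn_gt0 muln_gt0 /=.
  by case/orP => /card_gt0P[j]; rewrite inE => /eqP <-; rewrite imset_f ?inE ?orbT.
move/leq_trans; apply; rewrite cardsU (leq_trans (leq_subr _ _)) //.
by rewrite (@leq_add _ _ 4 4) // (leq_trans (leq_imset_card _ _)) // card_ord.
Qed.

End Occurrences.

Local Open Scope complex_scope.

(** * Power sums and conjugation of fourth roots of unity *)

Section Root4.
Variable R : realType.

Lemma uniq_root4_seq : uniq (root4_seq R).
Proof.
have n10 : (1 : R) == 0 = false by rewrite oner_eq0.
have n11 : (1 : R) == -1 = false by rewrite eq_sym eqNr oner_eq0.
by rewrite /root4_seq //= !inE !negb_or !eq_complex /= !oppr0 !(eq_sym 0)
           ?eqr_oppLR ?oppr0 ?n10 ?n11 ?oppr_eq0 ?n10 !(eqxx, andbF).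
Qed.

Lemma big_root4 (phi : R[i] -> R[i]) :
  \sum_(v : root4 R) phi (ssval v) = phi 1 + phi (-1) + phi 'i%C + phi (- 'i%C).
Proof.
transitivity (\sum_(z <- root4_seq R) phi z); last first.
  by rewrite !big_cons big_nil addr0 !addrA.
have {2}<- : [seq val v | v : root4 R] = root4_seq R.
  by rewrite /image_mem enumT unlock val_seq_sub_enum // uniq_root4_seq.
by rewrite big_image.
Qed.

Lemma root4_expr4 (v : root4 R) : ssval v ^+ 4 = 1 :> R[i].
Proof.
have := ssvalP v; rewrite !inE => /or4P[] /eqP->; rewrite ?expr1n //.
- by rewrite -signr_odd expr0.
- by rewrite (exprM _ 2 2) sqr_i sqrrN expr1n.
- by rewrite (exprM _ 2 2) sqrrN sqr_i sqrrN expr1n.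
Qed.

(** Conjugation is inversion on the unit circle, and the inverse of a fourth root of unity is its
    cube. Conjugates thus become monomials again. *)
Lemma root4_conjc (v : root4 R) : conjc (ssval v) = ssval v ^+ 3 :> R[i].
Proof.
have v4 := root4_expr4 v.
have v0 : ssval v != 0.
  by apply/eqP => v0; move/eqP: v4; rewrite v0 expr0n eq_sym oner_eq0.
apply: (mulfI v0); rewrite -exprS v4.
by have := ssvalP v; rewrite !inE => /or4P[] /eqP->; simpc.
Qed.

(** Orthogonality of the characters of the cyclic group of order 4; only the residue of [k] modulo 4
    matters. *)
Lemma sum_root4_expr k : \sum_(v : root4 R) (ssval v : R[i]) ^+ k = 4 * (4 %| k)%N%:R.
Proof.
rewrite (big_root4 (fun z => z ^+ k)).
have i4 : ('i%C : R[i]) ^+ 4 = 1 by rewrite (exprM _ 2 2) sqr_i sqrrN expr1n.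
have N4 : (-1 : R[i]) ^+ 4 = 1 by rewrite -signr_odd expr0.
have red (z : R[i]) : z ^+ 4 = 1 -> z ^+ k = z ^+ (k %% 4).
  by move=> z4; rewrite {1}(divn_eq k 4) exprD mulnC exprM z4 expr1n mul1r.
rewrite (red 1) ?expr1n // (red (-1)) // (red 'i%C) // (red (- 'i%C)); last first.
  by rewrite (exprM _ 2 2) sqrrN sqr_i sqrrN expr1n.
rewrite /dvdn; have : (k %% 4 < 4)%N by rewrite ltn_mod.
case: (k %% 4)%N => [|[|[|[|//]]]] _ /=; rewrite ?mulr0 ?mulr1.
- by rewrite !expr0; ring.
- by rewrite !expr1; ring.
- by rewrite !sqrrN sqr_i expr1n; ring.
- by rewrite !exprS expr0 !mulr1; ring.
Qed.
End Root4.

(** * First and second moments of a product of four sketches *)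

Section Moments.
Variables (R : realType) (d : nat) (p : {ffun 'I_d -> root4 R} -> R).
Local Notation C := R[i].
Hypothesis p_ge0 : forall f, 0 <= p f.
(** Uniformity and 8-wise independence in one formula: prescribing the values on at most 8 indices
    has the probability of independent uniform choices. *)
Hypothesis p_marginal : forall (J : {set 'I_d}) (g : {ffun 'I_d -> root4 R}),
  (#|J| <= 8)%N ->
  \sum_(f : {ffun 'I_d -> root4 R} | [forall i in J, f i == g i]) p f = 4^-1 ^+ #|J|.

Lemma expect_prod (J : {set 'I_d}) (phi : 'I_d -> root4 R -> C) :
    (#|J| <= 8)%N ->
  \sum_f (p f)%:C * \prod_(i in J) phi i (f i) =
  \prod_(i in J) (4^-1 * \sum_v phi i v).
Proof.
(* [v0] is the dummy value outside [J], so that each pattern on [J] is represented by exactly one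
   function in [pffun_on]. *)
move=> J8; pose v0 : root4 R := SeqSub (mem_head _ _ : 1 \in root4_seq R).
rewrite big_split /= prodr_const (big_distr_big v0) /= mulr_sumr.
have distr f : \prod_(i in J) phi i (f i) =
    \sum_(g in pffun_on v0 (mem J) predT)
      (if [forall i in J, f i == g i] then \prod_(i in J) phi i (g i) else 0).
  transitivity (\prod_(i in J) \sum_v (if f i == v then phi i v else 0)).
    apply: eq_bigr => i _; rewrite -big_mkcond (bigD1 (f i)) //= big1 ?addr0 //.
    by move=> v /andP[/eqP ->]; rewrite eqxx.
  rewrite (big_distr_big v0); apply: eq_bigr => g _.
  case: ifPn => [/forall_inP fg|].
    by apply: eq_bigr => i /fg ->.
  rewrite negb_forall_in => /existsP[i /andP[iJ /negPf fg]].
  by rewrite (bigD1 i) //= fg mul0r.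
under eq_bigr => f _ do rewrite distr mulr_sumr.
rewrite exchange_big; apply: eq_bigr => g _ /=.
transitivity ((\sum_(f : {ffun 'I_d -> root4 R} | [forall i in J, f i == g i]) p f)%:C *
              \prod_(i in J) phi i (g i)).
  rewrite rmorph_sum mulr_suml [RHS]big_mkcond; apply: eq_bigr => f _ /=.
  by case: ifP; rewrite // mulr0.
by rewrite p_marginal // rmorphXn /= fmorphV rmorph_nat.
Qed.

Lemma expect_monomial (e : 'I_d -> nat) :
    (#|[set i | e i != 0%N]| <= 8)%N ->
  \sum_f (p f)%:C * \prod_i (ssval (f i) : C) ^+ e i =
  [forall i, 4 %| e i]%N%:R.
Proof.
move=> e8; pose J := [set i | e i != 0%N].
transitivity (\sum_f (p f)%:C * \prod_(i in J) (ssval (f i) : C) ^+ e i).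
  apply: eq_bigr => f _; congr (_ * _); rewrite [RHS]big_mkcond.
  by apply: eq_bigr => i _; rewrite inE; case: eqP => //= ->; rewrite expr0.
rewrite (@expect_prod J (fun i v => ssval v ^+ e i)) //.
have c0 i : 4^-1 * (\sum_(v : root4 R) (ssval v : C) ^+ e i) = (4 %| e i)%N%:R.
  by rewrite sum_root4_expr mulrA mulVf ?mul1r // pnatr_eq0.
under eq_bigr do rewrite c0.
case: forallP => [e4|/forallP]; first by rewrite big1 // => i _; rewrite e4.
rewrite negb_forall => /existsP[i ei].
rewrite (bigD1 i) /= ?(negPf ei) ?mul0r //.
by rewrite inE; apply: contraNneq ei => ->.
Qed.

Variable u : 'I_4 -> 'I_d -> R.

(** The four coefficient vectors are kept separate; the basic estimate is the case [x, x, w, w]. *)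
Definition sketch4 (f : {ffun 'I_d -> root4 R}) : C :=
  \prod_j \sum_i (u j i)%:C * ssval (f i).

Local Notation U t := (\prod_j u j (t j)).

Lemma sketch4E f :
  sketch4 f = \sum_(t : {ffun 'I_4 -> 'I_d}) (U t)%:C * \prod_j ssval (f (t j)).
Proof.
by rewrite /sketch4 bigA_distr_bigA; apply: eq_bigr => t _;
   rewrite big_split /= rmorph_prod.
Qed.

Lemma conjc_sketch4E f :
  conjc (sketch4 f) =
  \sum_(t : {ffun 'I_4 -> 'I_d}) (U t)%:C * \prod_j ssval (f (t j)) ^+ 3.
Proof.
rewrite sketch4E rmorph_sum; apply: eq_bigr => t _ /=.
rewrite rmorphM; congr (_ * _); first exact: conjc_real.
by rewrite rmorph_prod; apply: eq_bigr => j _; exact: root4_conjc.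
Qed.

Lemma sum_constant_ffun (V : 'I_4 -> 'I_d -> R) :
  \sum_(t : {ffun 'I_4 -> 'I_d} | constant_ffun t) \prod_j V j (t j) =
  \sum_i \prod_j V j i.
Proof.
rewrite (reindex_onto (fun i : 'I_d => [ffun=> i]) (fun t => t ord0)) /=.
  apply: eq_big => [i|i _]; last by apply: eq_bigr => j _; rewrite ffunE.
  by rewrite ffunE eqxx andbT; apply/forallP => j; rewrite !ffunE.
by move=> t /forallP tc; apply/ffunP => j; rewrite ffunE (eqP (tc j)).
Qed.

Lemma expect_sketch4 :
  \sum_f (p f)%:C * sketch4 f = (\sum_i \prod_j u j i)%:C.
Proof.
under eq_bigr => f _ do rewrite sketch4E mulr_sumr.
rewrite exchange_big -sum_constant_ffun rmorph_sum [RHS]big_mkcond /=.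
apply: eq_bigr => t _; rewrite -dvdn4_occ.
transitivity ((U t)%:C * \sum_f (p f)%:C * \prod_i (ssval (f i) : C) ^+ occ t i).
  rewrite mulr_sumr; apply: eq_bigr => f _.
  by rewrite mulrCA (prod_occ t (fun i => ssval (f i) : C)).
rewrite expect_monomial; last first.
  apply: leq_trans (card_occ_support t t); apply/subset_leq_card/fintype.subsetP => i.
  by rewrite !inE; apply: contra; rewrite addn_eq0 => /andP[].
by case: ifP; rewrite ?mulr1 ?mulr0.
Qed.

(** Conjugation triples the exponents of the second tuple, so a pair contributes exactly when every
    combined exponent is a multiple of 4. *)
Lemma expect_sketch4_sqr :
  \sum_f (p f)%:C * (sketch4 f * conjc (sketch4 f)) =
  (\sum_(t : {ffun 'I_4 -> 'I_d}) \sum_(s : {ffun 'I_4 -> 'I_d})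
     U t * U s * [forall i, 4 %| occ t i + 3 * occ s i]%N%:R)%:C.
Proof.
transitivity (\sum_f \sum_(t : {ffun 'I_4 -> 'I_d}) \sum_(s : {ffun 'I_4 -> 'I_d})
    (U t * U s)%:C *
    ((p f)%:C * \prod_i (ssval (f i) : C) ^+ (occ t i + 3 * occ s i))).
  apply: eq_bigr => f _; rewrite conjc_sketch4E sketch4E mulr_suml mulr_sumr.
  apply: eq_bigr => t _; rewrite !mulr_sumr; apply: eq_bigr => s _.
  rewrite (prod_occ t (fun i => ssval (f i) : C)).
  rewrite (prod_occ s (fun i => (ssval (f i) : C) ^+ 3)).
  have -> : \prod_i (ssval (f i) : C) ^+ (occ t i + 3 * occ s i) =
      \prod_i (ssval (f i) : C) ^+ occ t i *
      \prod_i ((ssval (f i) : C) ^+ 3) ^+ occ s i.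
    by rewrite -big_split; apply: eq_bigr => i _; rewrite exprD exprM.
  by rewrite rmorphM; ring.
rewrite exchange_big rmorph_sum; apply: eq_bigr => t _ /=.
rewrite exchange_big rmorph_sum; apply: eq_bigr => s _ /=.
rewrite -mulr_sumr expect_monomial ?card_occ_support // [RHS]rmorphM /=.
by rewrite rmorph_nat.
Qed.

(** The factor 24 counts the permutations of four positions; the other term collects the pairs of
    constant tuples. *)
Lemma expect_sketch4_sqr_le :
  \sum_f p f * complex.Re (sketch4 f) ^+ 2 <=
  24 * \prod_j \sum_i u j i ^+ 2 + (\sum_i `|\prod_j u j i|) ^+ 2.
Proof.
pose K (t s : {ffun 'I_4 -> 'I_d}) : bool := [forall i, 4 %| occ t i + 3 * occ s i]%N.
have -> : \prod_j \sum_i u j i ^+ 2 = \sum_(t : {ffun 'I_4 -> 'I_d}) U t ^+ 2.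
  by rewrite bigA_distr_bigA; apply: eq_bigr => t _; rewrite prodrXl.
(* The squared real part is at most the squared modulus, whose expectation is known exactly. *)
have step1 : \sum_f p f * complex.Re (sketch4 f) ^+ 2 <=
    \sum_(t : {ffun 'I_4 -> 'I_d}) \sum_(s : {ffun 'I_4 -> 'I_d})
       U t * U s * (K t s)%:R.
  rewrite -lecR -expect_sketch4_sqr rmorph_sum; apply: ler_sum => f _ /=.
  rewrite rmorphM ler_wpM2l ?ler0c //.
  have -> : sketch4 f * conjc (sketch4 f) =
      (complex.Re (sketch4 f) ^+ 2 + complex.Im (sketch4 f) ^+ 2)%:C.
    case: (sketch4 f) => a b /=; simpc; apply/eqP; rewrite eq_complex /=.
    by apply/andP; split; apply/eqP; ring.
  by rewrite lecR lerDl sqr_ge0.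
apply: le_trans step1 _.
pose perm_term (t s : {ffun 'I_4 -> 'I_d}) (sigma : 'S_4) : bool :=
  s == [ffun j => t (sigma j)].
(* A tuple with repeated entries is counted by several [sigma], which is harmless in an upper
   bound. *)
have K_le t s : (K t s)%:R <=
    \sum_sigma (perm_term t s sigma)%:R + (constant_ffun t && constant_ffun s)%:R :> R.
  have [/forallP|_] := boolP (K t s); last first.
    by rewrite addr_ge0 ?sumr_ge0.
  case/dvdn4_occD3 => [[sigma st]|[-> ->]]; last by rewrite lerDr sumr_ge0.
  rewrite (bigD1 sigma) //= /perm_term st eqxx -addrA lerDl.
  by rewrite addr_ge0 ?sumr_ge0.
apply: (@le_trans _ _ (\sum_(t : {ffun 'I_4 -> 'I_d}) \sum_(s : {ffun 'I_4 -> 'I_d})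
    (\sum_(sigma : 'S_4) `|U t| * `|U s| * (perm_term t s sigma)%:R +
     `|U t| * `|U s| * (constant_ffun t && constant_ffun s)%:R))).
  apply: ler_sum => t _; apply: ler_sum => s _.
  rewrite -mulr_sumr -mulrDr -normrM.
  apply: (@le_trans _ _ (`|U t * U s| * (K t s)%:R)).
    by rewrite ler_wpM2r // ler_norm.
  exact: ler_wpM2l.
under eq_bigr do rewrite big_split /=.
rewrite big_split /=; apply: lerD; last first.
  have -> : \sum_i `|\prod_j u j i| =
      \sum_(t : {ffun 'I_4 -> 'I_d} | constant_ffun t) `|U t|.
    under [RHS]eq_bigr do rewrite normr_prod.
    rewrite (sum_constant_ffun (fun j i => `|u j i|)).
    by apply: eq_bigr => i _; rewrite normr_prod.
  rewrite expr2 mulr_suml [leRHS]big_mkcond; apply: ler_sum => t _.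
  case: ifP => _ /=; last by rewrite big1 // => s _; rewrite mulr0.
  rewrite mulr_sumr [leRHS]big_mkcond; apply: ler_sum => s _.
  by case: ifP; rewrite ?mulr1 ?mulr0.
under eq_bigr do rewrite exchange_big /=.
rewrite exchange_big /=.
have -> : 24 * (\sum_(t : {ffun 'I_4 -> 'I_d}) U t ^+ 2) =
    \sum_(sigma : 'S_4) \sum_(t : {ffun 'I_4 -> 'I_d}) U t ^+ 2.
  by rewrite sumr_const card_Sn -[RHS]mulr_natl.
apply: ler_sum => sigma _.
pose act (sigma : 'S_4) (t : {ffun 'I_4 -> 'I_d}) := [ffun j => t (sigma j)].
have actK : cancel (act sigma) (act (sigma^-1)%g).
  by move=> t; apply/ffunP => j; rewrite !ffunE permKV.
have actU : \sum_t U (act sigma t) ^+ 2 = \sum_(t : {ffun 'I_4 -> 'I_d}) U t ^+ 2.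
  by rewrite [RHS](reindex_inj (can_inj actK)).
(* AM-GM on [U t] and [U (act sigma t)]. Permuting tuples is a bijection, so both squares have the
   same sum over [t]. *)
apply: (@le_trans _ _ (\sum_(t : {ffun 'I_4 -> 'I_d})
    (U t ^+ 2 + U (act sigma t) ^+ 2) / 2)); last first.
  by rewrite -mulr_suml big_split /= actU; lra.
apply: ler_sum => t _.
rewrite (bigD1 (act sigma t)) //= /perm_term eqxx mulr1 [X in _ + X]big1 ?addr0; last first.
  by move=> s /negPf ->; rewrite mulr0.
rewrite -(real_normK (num_real (U t))) -(real_normK (num_real (U (act sigma t)))).
by have := sqr_ge0 (`|U t| - `|U (act sigma t)|); rewrite sqrrB; lra.
Qed.

End Moments.

Section ComplexRe.
Variable R : rcfType.

Lemma Re_sum (I : Type) (s : seq I) (Q : pred I) (z : I -> R[i]) :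
  complex.Re (\sum_(i <- s | Q i) z i) = \sum_(i <- s | Q i) complex.Re (z i).
Proof. by apply: (big_morph (@complex.Re R)) => // -[a b] [a' b']. Qed.

Lemma Re_realM (c : R) (z : R[i]) : complex.Re (c%:C * z) = c * complex.Re z.
Proof. by case: z => a b /=; rewrite mul0r subr0. Qed.
End ComplexRe.

(** * Mean, variance and failure probability of one row *)

Section RowEstimate.
Variables (R : realType) (d : nat) (x w : 'rV[R]_d).
Local Notation F := {ffun 'I_d -> root4 R}.
Local Notation est f := (complex.Re (basic_estimate x w f)).

Definition sketch4_coef (j : 'I_4) (i : 'I_d) : R :=
  if (j < 2)%N then x 0 i else w 0 i.

Lemma big_sketch4_coef (A : comNzRingType) (phi : ('I_d -> R) -> A) :
  \prod_j phi (sketch4_coef j) = phi (x 0) ^+ 2 * phi (w 0) ^+ 2.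
Proof. by rewrite !big_ord_recl big_ord0 /= mulr1 !expr2 !mulrA. Qed.

Lemma basic_estimateE f : basic_estimate x w f = sketch4 sketch4_coef f.
Proof.
by rewrite /sketch4 (big_sketch4_coef (fun v => \sum_i (v i)%:C * ssval (f i))).
Qed.

Lemma wnorm_sqr : wnorm w x ^+ 2 = \sum_i \prod_j sketch4_coef j i.
Proof.
rewrite sqr_sqrtr; last by apply: sumr_ge0 => i _; rewrite mulr_ge0 ?sqr_ge0.
by apply: eq_bigr => i _; rewrite (big_sketch4_coef (fun v => v i)) mulrC.
Qed.

Lemma l2norm_sqr (v : 'rV[R]_d) : l2norm v ^+ 2 = \sum_i v 0 i ^+ 2.
Proof. by rewrite sqr_sqrtr // sumr_ge0 // => i _; rewrite sqr_ge0. Qed.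

Lemma wnorm_le_l2norm : wnorm w x ^+ 2 <= (l2norm x * l2norm w) ^+ 2.
Proof.
rewrite exprMn !l2norm_sqr wnorm_sqr mulr_suml; apply: ler_sum => i _.
rewrite (big_sketch4_coef (fun v => v i)) ler_wpM2l ?sqr_ge0 //.
by rewrite (bigD1 i) //= lerDl sumr_ge0 // => k _; rewrite sqr_ge0.
Qed.

Section Law.
Variable p : F -> R.
Hypothesis p_ge0 : forall f, 0 <= p f.
Hypothesis p_marginal : forall (J : {set 'I_d}) (g : F),
  (#|J| <= 8)%N -> \sum_(f : F | [forall i in J, f i == g i]) p f = 4^-1 ^+ #|J|.

Lemma sum_marginal : \sum_f p f = 1.
Proof.
pose v0 : root4 R := SeqSub (mem_head _ _ : 1 \in root4_seq R).
have := @p_marginal finset.set0 [ffun=> v0].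
rewrite cards0 expr0 => /(_ isT) <-; apply: eq_bigl => f.
by apply/esym/forall_inP => i; rewrite inE.
Qed.

Lemma expect_est : \sum_f p f * est f = wnorm w x ^+ 2.
Proof.
have := congr1 (@complex.Re R) (expect_sketch4 p_marginal sketch4_coef).
rewrite -wnorm_sqr Re_sum => e; rewrite -[RHS]e; apply: eq_bigr => f _.
by rewrite Re_realM basic_estimateE.
Qed.

(** With [N] the squared product of the Euclidean norms, the second moment is at most
    [24 * N ^+ 2 + mu ^+ 2], and [mu <= N]. *)
Lemma variance_est :
  \sum_f p f * (est f - wnorm w x ^+ 2) ^+ 2 <= 25 * (l2norm x * l2norm w) ^+ 4.
Proof.
set mu := wnorm w x ^+ 2; pose N := (l2norm x * l2norm w) ^+ 2.
have -> : \sum_f p f * (est f - mu) ^+ 2 = \sum_f p f * est f ^+ 2 - mu ^+ 2.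
  rewrite (eq_bigr (fun f => p f * est f ^+ 2 - (2 * mu) * (p f * est f) + mu ^+ 2 * p f)).
    rewrite !big_split /= sumrN -!mulr_sumr expect_est sum_marginal -/mu; ring.
  by move=> f _; ring.
have := expect_sketch4_sqr_le p_ge0 p_marginal sketch4_coef.
rewrite (eq_bigr (fun f => p f * est f ^+ 2)); last by move=> f _; rewrite basic_estimateE.
rewrite (big_sketch4_coef (fun v => \sum_i v i ^+ 2)) -!l2norm_sqr.
have -> : \sum_i `|\prod_j sketch4_coef j i| = mu.
  rewrite /mu wnorm_sqr; apply: eq_bigr => i _; rewrite ger0_norm //.
  by rewrite (big_sketch4_coef (fun v => v i)) mulr_ge0 ?sqr_ge0.
have muN : mu ^+ 2 <= N ^+ 2.
  by rewrite ler_sqr ?nnegrE ?sqr_ge0 // wnorm_le_l2norm.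
rewrite (_ : (l2norm x * l2norm w) ^+ 4 = N ^+ 2); last by rewrite -exprM.
rewrite (_ : (_ ^+ 2) ^+ 2 * _ = N ^+ 2); last by rewrite -exprMn -exprMn.
by have := sqr_ge0 mu; nra.
Qed.
End Law.

Lemma row_estimate_fail (m : nat) (q : 'I_m -> F -> R) (eps : R) :
    (forall b f, 0 <= q b f) ->
    (forall b (J : {set 'I_d}) (g : F), (#|J| <= 8)%N ->
       \sum_(f : F | [forall i in J, f i == g i]) q b f = 4^-1 ^+ #|J|) ->
    0 < wnorm w x -> 0 < eps -> (0 < m)%N ->
    136 / eps ^+ 2 * distortion x w ^+ 4 < m%:R ->
  \sum_(g : {ffun 'I_m -> F} |
     ~~ ((1 - eps) * wnorm w x ^+ 2 < row_estimate x w g < (1 + eps) * wnorm w x ^+ 2))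
     prodw q g <= 4^-1.
Proof.
move=> q0 qm w0 e0 m0 hm; set mu := wnorm w x ^+ 2.
have mR : 0 < m%:R :> R by rewrite ltr0n.
have mu0 : 0 < mu by rewrite exprn_gt0.
pose Z (b : 'I_m) (f : F) := est f - mu.
have rowE (g : {ffun 'I_m -> F}) :
    row_estimate x w g = m%:R^-1 * \sum_b est (g b).
  rewrite /row_estimate -Re_sum -Re_realM; congr (complex.Re (_ * _)).
  by rewrite fmorphV rmorph_nat.
have ZE (g : {ffun 'I_m -> F}) : \sum_b Z b (g b) = m%:R * (row_estimate x w g - mu).
  rewrite rowE mulrBr mulrA divff ?gt_eqF // mul1r sumrB.
  by rewrite sumr_const card_ord mulr_natl.
have Z0 b : \sum_f q b f * Z b f = 0.
  under eq_bigr do rewrite mulrBr.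
  by rewrite sumrB -mulr_suml (expect_est (qm b)) (sum_marginal (qm b)) mul1r subrr.
(* Chebyshev is applied to the unnormalised sum over [b], where a relative error [eps] becomes the
   threshold [m * eps * mu]. *)
have c0 : 0 <= m%:R * (eps * mu) by rewrite !mulr_ge0 // ltW.
have q1 b : \sum_f q b f = 1 by exact: (sum_marginal (qm b)).
have cheb := prodw_chebyshev q0 q1 Z0 c0.
set S := \sum_(g | ~~ _) _.
have {}cheb : (m%:R * (eps * mu)) ^+ 2 * S <= m%:R * (25 * (l2norm x * l2norm w) ^+ 4).
  apply: (le_trans (le_trans _ cheb)).
    rewrite ler_wpM2l ?sqr_ge0 // /S big_mkcond [leRHS]big_mkcond.
    apply: ler_sum => g _; case: ifP => [gbad|_]; last first.
      by case: ifP => // _; apply: prodw_ge0.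
    rewrite ZE normrM ger0_norm ?ler0n // ler_pM2l // ifT //.
    apply: contraTT gbad; rewrite negbK -ltNge ltr_norml => /andP[lo hi].
    by apply/andP; split; lra.
  rewrite mulr_natl -[X in _ *+ X]card_ord -sumr_const.
  by apply: ler_sum => b _; exact: (variance_est (q0 b) (qm b)).
move: hm; rewrite /distortion expr_div_n.
rewrite (_ : wnorm w x ^+ 4 = mu ^+ 2); last by rewrite -exprM.
set N := (l2norm x * l2norm w) ^+ 4 in cheb *.
(* The hypothesis on [m] becomes [136 * N < m * (eps * mu) ^+ 2]. Against the numerator [25 * N]
   this gives [25 / 136 < 1 / 4]. *)
rewrite mulf_div -exprMn ltr_pdivrMr ?exprn_gt0 ?mulr_gt0 // => hm.
have M0 : 0 < (eps * mu) ^+ 2 by rewrite exprn_gt0 ?mulr_gt0.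
have {}cheb : m%:R * (eps * mu) ^+ 2 * S <= 25 * N.
  by rewrite -(ler_pM2l mR) (le_trans _ cheb) // le_eqVlt; apply/orP/or_introl/eqP; ring.
have mM0 : 0 < m%:R * (eps * mu) ^+ 2 by rewrite mulr_gt0.
rewrite -(ler_pM2l mM0); apply: (le_trans cheb); lra.
Qed.

Lemma rho_in_interval (r m : nat) (G : 'I_r -> 'I_m -> F) (lo hi : R) :
    (2 * #|[set a | ~~ (lo < row_estimate x w (G a) < hi)%R]| < r)%N ->
  lo < rho x w G < hi.
Proof.
move=> bad; apply: median_in_interval; rewrite size_map size_enum_ord.
rewrite count_map count_enum; congr (2 * _ < r)%N: bad.
by apply: eq_card => a; rewrite inE.
Qed.
End RowEstimate.

(** * From the probability space to laws on finite sets *)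

Section FiniteLaw.
Context {disp : measure_display} {T : measurableType disp} {R : realType}.
Variable P : probability T R.
Local Open Scope classical_set_scope.

Definition pmf (F : finType) (X : T -> F) (f : F) : R := fine (P (X @^-1` [set f])).

Lemma pmf_ge0 (F : finType) (X : T -> F) f : 0 <= pmf X f.
Proof. exact: fine_ge0. Qed.

Lemma probability_pmf (F : finType) (X : T -> F) (Q : pred F) :
    (forall f, measurable (X @^-1` [set f])) ->
  P [set omega | Q (X omega)] = (\sum_(f | Q f) pmf X f)%:E.
Proof.
move=> mX.
have -> : [set omega | Q (X omega)] = \bigcup_(f in [set` Q]) X @^-1` [set f].
  apply/seteqP; split => [omega /= Qo|omega [f /= Qf ->]] //.
  by exists (X omega).
rewrite measure_fin_bigcup //; last first.
  apply/trivIsetP => f g _ _ fg; apply/seteqP; split => // o; case => /= Xf Xg.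
  by rewrite -Xf -Xg eqxx in fg.
rewrite -(@bigfs _ _ _ _ (index_enum F)) ?index_enum_uniq //; last first.
  by move=> f _; rewrite mem_index_enum.
rewrite -sumEFin; apply: eq_bigr => f _; rewrite /pmf fineK //.
by apply: fin_num_measure.
Qed.

(** The product rule for singleton events, each of probability [1 / 4]; it supplies the marginal
    hypothesis of the moment computations. *)
Lemma pmf_marginal (d : nat) (X : T -> {ffun 'I_d -> root4 R}) (k : nat)
    (J : {set 'I_d}) (g : {ffun 'I_d -> root4 R}) :
    random_element X ->
    k_wise_independent P k (fun t omega => X omega t) ->
    (forall t, uniformly_distributed P (fun omega => X omega t)) ->
    (#|J| <= k)%N ->
  \sum_(f : {ffun 'I_d -> root4 R} | [forall i in J, f i == g i]) pmf X f
    = 4^-1 ^+ #|J|.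
Proof.
move=> mX indep unif Jk; apply: EFin_inj; rewrite -probability_pmf //.
have := indep J Jk (fun i => [set g i]).
have -> : \bigcap_(i in [set` J]) ((fun omega => X omega i) @^-1` [set g i]) =
    [set omega | [forall i in J, X omega i == g i]].
  apply/seteqP; split => omega /=.
    by move=> Xg; apply/forall_inP => i iJ; apply/eqP/Xg.
  by move=> /forall_inP Xg i iJ; apply/eqP/Xg.
move=> ->; rewrite (eq_bigr (fun=> (4^-1)%:E)); last first.
  by move=> i _; rewrite unif card_root4.
by rewrite prodEFin prodr_const.
Qed.

(** Fixing the whole array is the intersection of all single-entry events, so the product rule over
    all pairs factors its probability; grouping by rows nests the two products. *)
Lemma pmf_independent (r m : nat) (F : finType) (h : 'I_r -> 'I_m -> T -> F)
    (G : {ffun 'I_r -> {ffun 'I_m -> F}}) :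
    mutually_independent P (fun ab : 'I_r * 'I_m => h ab.1 ab.2) ->
    (forall a b, random_element (h a b)) ->
  let H omega := [ffun a => [ffun b => h a b omega]] in
  measurable (H @^-1` [set G]) /\
  pmf H G = prodw (fun a => prodw (fun b => pmf (h a b))) G.
Proof.
move=> indep mh H.
have HE : H @^-1` [set G] = \bigcap_(ab in [set` [set: 'I_r * 'I_m]%SET])
    (h ab.1 ab.2 @^-1` [set G ab.1 ab.2]).
  apply/seteqP; split => omega /=.
    by move=> <- [a b] _ /=; rewrite /H !ffunE.
  move=> hG; apply/ffunP => a; rewrite ffunE; apply/ffunP => b; rewrite ffunE.
  by apply: (hG (a, b)); rewrite /= inE.
split.
  by rewrite HE; apply: fin_bigcap_measurable => [|ab _]; [exact: finite_finset|exact: mh].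
rewrite /pmf HE indep.
rewrite (eq_bigr (fun ab => (pmf (h ab.1 ab.2) (G ab.1 ab.2))%:E)); last first.
  by move=> ab _; rewrite /pmf fineK //; apply: fin_num_measure; exact: mh.
rewrite prodEFin /= /prodw pair_bigA; apply: eq_bigl => ab.
by rewrite inE.
Qed.
End FiniteLaw.

(** * Exponential tail and conclusion *)

Lemma expr_seven_eighths_le (R : realType) (r : nat) (delta : R) :
  0 < delta -> 12 * ln (1 / delta) < r%:R -> (7 / 8) ^+ r <= delta.
Proof.
move=> d0; rewrite div1r lnV ?posrE // => hr.
(* [expR (- 12^-1)] is at least [1 - 1 / 12 = 11 / 12], which exceeds [7 / 8]. *)
have e78 : 7 / 8 <= expR (- 12^-1) :> R.
  by apply: le_trans (expR_ge1Dx _); lra.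
apply: (@le_trans _ _ (expR (- 12^-1) ^+ r)).
  by rewrite lerXn2r ?nnegrE ?expR_ge0 //; lra.
by rewrite -expRM_natl -[leRHS](@lnK R) ?posrE // ler_expR; lra.
Qed.

Local Open Scope classical_set_scope.

Theorem theorem4p3 (R : realType)
  (disp : measure_display) (T : measurableType disp) (P : probability T R)
  (d r m : nat) (x w : 'rV[R]_d) (eps delta : R)
  (h : 'I_r -> 'I_m -> T -> {ffun 'I_d -> root4 R})
  (hxw : 0 < wnorm w x)
  (heps : 0 < eps)
  (hdelta0 : 0 < delta) (hdelta1 : delta < 1)
  (hr0 : (0 < r)%N) (hm0 : (0 < m)%N)
  (hm : 136 / eps ^+ 2 * distortion x w ^+ 4 < m%:R)
  (hr : 12 * ln (1 / delta) < r%:R)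
  (hrandom : forall a b, random_element (h a b))
  (hindep : mutually_independent P (fun ab : 'I_r * 'I_m => h ab.1 ab.2))
  (h8wise : forall a b,
    k_wise_independent P 8 (fun (t : 'I_d) (omega : T) => h a b omega t))
  (hunif : forall a b (t : 'I_d),
    uniformly_distributed P (fun omega : T => h a b omega t)) :
  ((1 - delta)%:E <=
   P [set omega : T |
       ((1 - eps) * wnorm w x ^+ 2 < rho x w (fun a b => h a b omega))%R /\
       (rho x w (fun a b => h a b omega) < (1 + eps) * wnorm w x ^+ 2)%R])%E.
Proof.
pose lo : R := (1 - eps) * wnorm w x ^+ 2; pose hi : R := (1 + eps) * wnorm w x ^+ 2.
pose H omega : {ffun 'I_r -> {ffun 'I_m -> {ffun 'I_d -> root4 R}}} :=
  [ffun a => [ffun b => h a b omega]].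
pose good (G : {ffun 'I_r -> {ffun 'I_m -> {ffun 'I_d -> root4 R}}}) :=
  lo < rho x w (fun a b => G a b) < hi.
have -> : [set omega : T | (lo < rho x w (fun a b => h a b omega))%R /\
                           (rho x w (fun a b => h a b omega) < hi)%R] =
          [set omega | good (H omega)].
  have HE omega : (fun a b => h a b omega) = (fun a b => H omega a b).
    by apply/funext => a; apply/funext => b; rewrite !ffunE.
  by apply/seteqP; split => omega /=; rewrite HE => /andP.
pose q a b := pmf P (h a b).
have mH G : measurable (H @^-1` [set G]) by have [] := pmf_independent G hindep hrandom.
have HE G : pmf P H G = prodw (fun a => prodw (q a)) G.
  by have [] := pmf_independent G hindep hrandom.
rewrite probability_pmf // lee_fin; under eq_bigr do rewrite HE.
have q0 a b f : 0 <= q a b f by exact: pmf_ge0.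
have qm a b J g := @pmf_marginal _ _ _ P d (h a b) 8 J g
  (hrandom a b) (h8wise a b) (hunif a b).
have q1 a : \sum_g prodw (q a) g = 1.
  by apply: sum_prodw => b; apply: sum_marginal (qm a b).
have w0 a g : 0 <= prodw (q a) g by exact: prodw_ge0.
(* Splitting the total mass 1 into good and bad arrays reduces the goal to bounding the mass of the
   bad ones by [delta]. *)
have := sum_prodw q1; rewrite (bigID good) /= => <-.
rewrite -addrA gerDl subr_le0.
apply: le_trans (expr_seven_eighths_le hdelta0 hr).
pose bad (a : 'I_r) (g : {ffun 'I_m -> {ffun 'I_d -> root4 R}}) :=
  ~~ (lo < row_estimate x w g < hi).
(* By [rho_in_interval], an array whose median fails has at least half of its rows bad, which is the
   Chernoff event. *)
rewrite -[in leRHS](card_ord r); apply: le_trans (prodw_chernoff w0 q1 (bad := bad) _).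
  rewrite big_mkcond [leRHS]big_mkcond; apply: ler_sum => G _.
  case: ifP => [nG|_]; last by case: ifP => // _; apply: prodw_ge0.
  rewrite ifT // card_ord leqNgt; apply: contra nG => bG.
  exact: rho_in_interval.
by move=> a; apply: row_estimate_fail => // b J g; exact: qm.
Qed.
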